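(* Let $A\in\mathbb{R}^{n\times n}$, $B\in\mathbb{R}^{n\times m}$, $C\in\mathbb{R}^{p\times n}$, $L\in\mathbb{R}^{n\times p}$, and let $M\in\mathbb{R}^{n\times (m+p)n}$ be the parameterization matrix associated with $(A,B,C,L)$ (defined in the context). If the pair $(A,B)$ is controllable, then $M$ has full row rank, i.e. $\operatorname{rank}(M)=n$.
   Context: Definition of $M$. Let $\Lambda(s)=\det(sI-A+LC)=s^n+\alpha_{n-1}s^{n-1}+\cdots+\alpha_1 s+\alpha_0$, and let $D_0,\dots,D_{n-1}\in\mathbb{R}^{n\times n}$ be the constant matrices with $$(sI-A+LC)^{-1}=\frac{D_{n-1}s^{n-1}+D_{n-2}s^{n-2}+\cdots+D_1 s+D_0}{\Lambda(s)}.$$ For $i=1,\dots,m$ let $f_i$ be the $i$-th column of $B$, and for $i=m+1,\dots,m+p$ let $f_i$ be the $(i-m)$-th column of $L$. Set $M_i=[D_0f_i,\ D_1f_i,\ \dots,\ D_{n-1}f_i]\in\mathbb{R}^{n\times n}$ and $M=[M_1,\dots,M_{m+p}]$. *)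

(* Defs.v *)
From mathcomp Require Import all_boot all_order all_algebra.
From mathcomp Require Import all_classical all_reals all_analysis.
Set Implicit Arguments.
Unset Strict Implicit.
Unset Printing Implicit Defensive.
Import Order.TTheory GRing.Theory Num.Theory.
Import numFieldNormedType.Exports.
Local Open Scope classical_set_scope.
Local Open Scope ring_scope.

Section Controllability.
Variables (R : realType) (n m : nat).
Variables (A : 'M[R]_n) (B : 'M[R]_(n, m)).

(* [x] is the (Caratheodory) solution on [0, T] of x' = A x + B u, x(0) = x0,
   for a Lebesgue-integrable input [u]. *)
Definition trajectory (T : R) (x0 : 'cV[R]_n)
    (u : R -> 'cV[R]_m) (x : R -> 'cV[R]_n) : Prop :=
  [/\ forall j, (@lebesgue_measure R).-integrable `[0, T]
        (EFin \o (fun t => u t j 0)),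
      forall i, {within `[0, T], continuous (fun t => x t i 0)} &
      forall t, t \in `[0, T] -> forall i,
        x t i 0 = x0 i 0 +
          \int[@lebesgue_measure R]_(tau in `[0, t])
            ((A *m x tau + B *m u tau) i 0)].

Definition controllable : Prop :=
  forall x0 x1 : 'cV[R]_n, exists (T : R) (u : R -> 'cV[R]_m)
    (x : R -> 'cV[R]_n),
    [/\ 0 < T, trajectory T x0 u x & x T = x1].

End Controllability.

Section Parameterization.
Variables (R : realType) (n m p : nat).
Variables (A : 'M[R]_n) (B : 'M[R]_(n, m)) (C : 'M[R]_(p, n)).
Variable (L : 'M[R]_(n, p)).

Definition observer_pencil : 'M[{poly R}]_n :=
  'X%:M - map_mx polyC A + map_mx polyC (L *m C).

Definition Lambda : {poly R} := \det observer_pencil.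

(* Identity of matrices over the field R(s) of rational functions; the inverse
   is a genuine one since [Lambda] is nonzero. *)
Definition resolvent_coefs (D : 'I_n -> 'M[R]_n) : Prop :=
  invmx (map_mx (@tofrac {poly R}) observer_pencil) =
  (tofrac Lambda)^-1 *:
    map_mx (@tofrac {poly R}) (\sum_(k < n) 'X^k *: map_mx polyC (D k)).

Definition input_col (i : 'I_(m + p)) : 'cV[R]_n := col i (row_mx B L).

Definition parameterization_block (D : 'I_n -> 'M[R]_n) (i : 'I_(m + p)) :
    'M[R]_n :=
  \matrix_(r, k) (D k *m input_col i) r 0.

Definition parameterization_mx (D : 'I_n -> 'M[R]_n) :
    'M[R]_(n, \sum_(i < m + p) n) :=
  \mxrow_(i < m + p) parameterization_block D i.

Lemma observer_pencilE : observer_pencil = char_poly_mx (A - L *m C).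
Proof. by rewrite /observer_pencil /char_poly_mx map_mxB opprB addrA addrAC. Qed.

Lemma LambdaE : Lambda = char_poly (A - L *m C).
Proof. by rewrite /Lambda observer_pencilE. Qed.

Lemma size_adj_char_poly_mx (N : 'M[R]_n) i j :
  (size (\adj (char_poly_mx N) i j) <= n)%N.
Proof.
rewrite mxE /cofactor size_Msign.
have n_gt0 : (0 < n)%N by apply: leq_ltn_trans (ltn_ord i).
apply: (leq_trans (size_sum _ _ _)); apply/bigmax_leqP => s _.
rewrite size_Msign; apply: (leq_trans (size_poly_prod_leq _ _)).
rewrite card_ord leq_subLR -ltnS.
apply: (@leq_ltn_trans (\sum_(k < n.-1) 2).+1%N).
  rewrite ltnS; apply: leq_sum => k _; rewrite !mxE.
  by apply: (leq_trans (size_polyD _ _)); rewrite geq_max size_polyN;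
    apply/andP; split; [case: eqP => _; rewrite ?mulr1n ?mulr0n ?size_polyX ?size_poly0
                       | exact: leq_trans (size_polyC_leq1 _) _].
rewrite sum_nat_const card_ord muln2 -addnn; move: n_gt0; case: (n) => //= k _.
by rewrite addnS.
Qed.

Lemma resolvent_coefs_ex : exists D, resolvent_coefs D.
Proof.
pose N := A - L *m C.
exists (fun k => \matrix_(i, j) (\adj (char_poly_mx N) i j)`_k).
rewrite /resolvent_coefs LambdaE observer_pencilE -/N.
have -> : \sum_(k < n) 'X^k *: map_mx polyC
    (\matrix_(i, j) (\adj (char_poly_mx N) i j)`_k) = \adj (char_poly_mx N).
  apply/matrixP => i j; rewrite summxE.
  have -> : \adj (char_poly_mx N) i j =
      \poly_(k < n) (\adj (char_poly_mx N) i j)`_k.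
    apply/polyP => k; rewrite coef_poly; case: ltnP => // le_nk.
    by rewrite nth_default // (leq_trans (size_adj_char_poly_mx N i j)).
  rewrite poly_def; apply: eq_bigr => k _.
  rewrite mxE [map_mx _ _ _ _]mxE [(\matrix_(_, _) _) _ _]mxE.
  by rewrite -mul_polyC mulrC.
rewrite /invmx unitmxE det_map_mx unitfE tofrac_eq0.
by rewrite (monic_neq0 (char_poly_monic N)) map_mx_adj.
Qed.

End Parameterization.

(* Main.v *)
Require Import Defs.
From mathcomp Require Import all_boot all_order all_algebra.
From mathcomp Require Import all_classical all_reals all_analysis.

(** Full row rank means that a row vector [v] with [v M = 0] vanishes.  Put
    [N = A - L C] and [F = (B L)]; then [v M = 0] says [v D_k F = 0] for
    every [k].

    Algebra: the row [w = v adj(s I - N)], the sum of the [s^k v D_k],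
    satisfies [w F = 0] and [w (s I - N) = Lambda v].  Hence
    [w N F = s w F - Lambda v F = - Lambda v F].  The entries of [w] have
    degree below [n] and [Lambda] has degree [n], so both sides vanish:
    [v F = 0] and [w N F = 0].  Repeating the argument with [N F], [N^2 F],
    and so on gives [v N^j F = 0] for all [j] ([char_poly_row_step]), that is
    [v N^j B = 0] and [v N^j L = 0].  Because of the latter the output
    injection [L C] is invisible to [v] ([row_output_injection]):
    [v A^j = v N^j], and therefore [v A^j B = 0] for all [j].

    Analysis: it remains to see that such a [v] contradicts controllability
    unless it is zero ([controllable_row_eq0]).  The span of the rows [v A^j]
    is invariant under [A] and killed by [B]: collecting spanning rows in [K],
    one has [K A = G K] and [K B = 0] ([row_Krylov_mx]).  Along a trajectory
    [x] from the origin, [y = K x] solves [y' = G y] with [y(0) = 0], so it is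
    zero by an energy estimate ([linear_ode_zero]).  Every state is the end of
    such a trajectory, so [K = 0], and [v] is in the row space of [K]. *)

Set Implicit Arguments.
Unset Strict Implicit.
Unset Printing Implicit Defensive.
Import Order.TTheory GRing.Theory Num.Theory.
Import numFieldNormedType.Exports.
Local Open Scope classical_set_scope.
Local Open Scope ring_scope.

(** * Rows killed by all the resolvent coefficients *)

(** The degree argument: [w] times [N F] equals minus [char_poly N] times the
    constant row [v F], and the entries of the former are too short to be a
    nonzero multiple of the characteristic polynomial.  The second conclusion
    is the hypothesis again, for [N F], so that the lemma iterates. *)
Lemma char_poly_row_step (R : fieldType) n q (N : 'M[R]_n) (v : 'rV[R]_n)
    (w : 'rV[{poly R}]_n) (F : 'M[R]_(n, q)) :
    (forall k, size (w 0%R k) <= n)%N ->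
    w *m char_poly_mx N = char_poly N *: map_mx polyC v ->
    w *m map_mx polyC F = 0 ->
  v *m F = 0 /\ w *m map_mx polyC (N *m F) = 0.
Proof.
move=> sw wP wF.
have wNF : w *m map_mx polyC (N *m F) =
    - (char_poly N *: map_mx polyC (v *m F)).
  rewrite [in RHS]map_mxM scalemxAl -wP -mulmxA /char_poly_mx mulmxBl.
  by rewrite mul_scalar_mx -map_mxM mulmxBr -scalemxAr wF scaler0 sub0r opprK.
suff vF : v *m F = 0 by rewrite wNF vF map_mx0 scaler0 oppr0.
apply/matrixP => i j; rewrite ord1 [RHS]mxE; apply/eqP.
(* Otherwise the right-hand side of [wNF] would have an entry of degree [n]. *)
apply: contraT; move: (v *m F) wNF => vF wNF vF0.
have := congr1 (fun M : 'rV[{poly R}]_q => size (M 0 j)) wNF.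
rewrite !mxE size_polyN [char_poly N * _]mulrC mul_polyC size_scale //.
rewrite size_char_poly => szw.
suff : (n.+1 <= n)%N by rewrite ltnn.
rewrite -szw; apply: (leq_trans (size_sum _ _ _)).
apply/bigmax_leqP => k _; rewrite [map_mx _ _ _ _]mxE mulrC mul_polyC.
exact: leq_trans (size_scale_leq _ _) (sw k).
Qed.

(** The defining identity of the coefficients, with the denominators of the
    field of fractions cleared: their generating polynomial matrix times
    [s I - N] is the characteristic polynomial, as for the adjugate. *)
Lemma resolvent_coefs_mul (R : realType) n p (A : 'M[R]_n) (C : 'M[R]_(p, n))
    (L : 'M[R]_(n, p)) (D : 'I_n -> 'M[R]_n) :
  resolvent_coefs A C L D ->
  (\sum_(k < n) 'X^k *: map_mx polyC (D k)) *m char_poly_mx (A - L *m C) =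
    (char_poly (A - L *m C))%:M.
Proof.
rewrite /resolvent_coefs LambdaE observer_pencilE.
set N := A - L *m C; set S := \sum_k _ => hD.
have tL0 : tofrac (char_poly N) != 0.
  by rewrite tofrac_eq0 monic_neq0 // char_poly_monic.
have uP : map_mx (@tofrac {poly R}) (char_poly_mx N) \in unitmx.
  by rewrite unitmxE det_map_mx unitfE.
have : map_mx (@tofrac {poly R}) (S *m char_poly_mx N) =
       map_mx (@tofrac {poly R}) (char_poly N)%:M.
  rewrite map_mxM map_scalar_mx.
  have -> : map_mx (@tofrac {poly R}) S = tofrac (char_poly N) *:
      invmx (map_mx (@tofrac {poly R}) (char_poly_mx N)).
    by rewrite hD scalerA mulfV // scale1r.
  by rewrite -scalemxAl mulVmx // scalemx1.
move=> eqSP; apply/matrixP => i j; apply/eqP.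
by rewrite -tofrac_eq; move/matrixP/(_ i j): eqSP; rewrite !mxE => ->.
Qed.

(** Modifying [A] by [L C] does not change the rows [v A^j] as long as [L]
    sends them to zero. *)
Lemma row_output_injection (F : fieldType) n p (A : 'M[F]_n.+1)
    (C : 'M[F]_(p, n.+1)) (L : 'M[F]_(n.+1, p)) (v : 'rV[F]_n.+1) j :
  (forall k, v *m (A - L *m C) ^+ k *m L = 0) ->
  v *m A ^+ j = v *m (A - L *m C) ^+ j.
Proof.
have AE : A = A - L *m C + L *m C by rewrite subrK.
move: (A - L *m C) AE => N AE vL.
elim: j => [|j IHj]; first by rewrite !expr0.
rewrite !exprSr !mulmxA IHj [in LHS]AE mulmxDr.
by rewrite [X in _ + X]mulmxA vL mul0mx addr0.
Qed.

(** * The Krylov space of a row *)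

(** The powers of [A] below the degree of its minimal polynomial span all the
    powers, so finitely many rows [v A^i] span a space invariant under [A];
    [G] is the matrix of [A] on it. *)
Lemma row_Krylov_mx (F : fieldType) n (A : 'M[F]_n.+1) (v : 'rV[F]_n.+1) :
  exists d (K : 'M[F]_(d, n.+1)) (G : 'M[F]_d),
    [/\ (v <= K)%MS, K *m A = G *m K &
        forall i, exists j : nat, row i K = v *m A ^+ j].
Proof.
pose K := \matrix_(i < degree_mxminpoly A) (v *m A ^+ i).
have powK j : (v *m A ^+ j <= K)%MS.
  have /submxP[u] := horner_mx_mem A 'X^j.
  rewrite rmorphXn /= horner_mx_X => /(congr1 vec_mx).
  rewrite mxvecK mulmx_sum_row linear_sum /= => ->.
  rewrite mulmx_sumr summx_sub // => i _.
  rewrite rowK linearZ /= mxvecK -scalemxAr scalemx_sub //.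
  by have := row_sub i K; rewrite rowK.
have /submxP[G KA] : (K *m A <= K)%MS.
  apply/row_subP => i; rewrite row_mul rowK -mulmxA.
  by rewrite -[A ^+ i *m A]/(A ^+ i * A) -exprSr powK.
exists _, K, G; split => //; first by have := powK 0; rewrite expr0 mulmx1.
by move=> i; exists i; rewrite rowK.
Qed.

(** * Uniqueness for linear differential equations in integral form *)

Section LinearOde.
Variable R : realType.
Notation mu := (@lebesgue_measure R).

Lemma integrable_lincomb (I : Type) (s : seq I) (D : set (measurableTypeR R))
    (a : I -> R) (f : I -> R -> R) :
    measurable D -> (forall j, mu.-integrable D (EFin \o f j)) ->
  mu.-integrable D (EFin \o (fun t => \sum_(j <- s) a j * f j t)).
Proof.
move=> mD intf.
rewrite (_ : _ \o _ = fun t => (\sum_(j <- s) (a j)%:E * (f j t)%:E)%E).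
  by apply: integrable_sum => // j _; exact: (integrableZl mD (a j) (intf j)).
by apply/funext => t /=; rewrite -sumEFin; apply: eq_bigr => j _; rewrite EFinM.
Qed.

Lemma Rintegral_lincomb (I : Type) (s : seq I) (D : set (measurableTypeR R))
    (a : I -> R) (f : I -> R -> R) :
    measurable D -> (forall j, mu.-integrable D (EFin \o f j)) ->
  \int[mu]_(t in D) (\sum_(j <- s) a j * f j t) =
  \sum_(j <- s) a j * \int[mu]_(t in D) f j t.
Proof.
move=> mD intf; elim: s => [|j s IHs].
  under eq_Rintegral do rewrite big_nil.
  by rewrite big_nil /Rintegral integral0.
under eq_Rintegral do rewrite big_cons.
rewrite big_cons RintegralD //.
- by rewrite IHs RintegralZl.
- exact: (integrableZl mD (a j) (intf j)).
- exact: integrable_lincomb.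
Qed.

Lemma quadratic_form_le (k : nat) (G : 'M[R]_k) (y : 'cV[R]_k) :
  \sum_i y i 0 * (G *m y) i 0 <= (\sum_i \sum_j `|G i j|) * \sum_i y i 0 ^+ 2.
Proof.
have S0 : 0 <= \sum_l y l 0 ^+ 2 by apply: sumr_ge0 => l _; exact: sqr_ge0.
have sq_le i : y i 0 ^+ 2 <= \sum_l y l 0 ^+ 2.
  by rewrite (bigD1 i) //= lerDl sumr_ge0 // => l _; exact: sqr_ge0.
rewrite mulr_suml; apply: ler_sum => i _.
rewrite mxE mulr_sumr mulr_suml; apply: ler_sum => j _.
rewrite mulrCA; apply: (le_trans (ler_norm _)); rewrite normrM.
rewrite ler_wpM2l // -ler_sqr ?nnegrE //.
by rewrite real_normK ?num_real // exprMn [leRHS]expr2 ler_pM ?sqr_ge0.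
Qed.

Lemma continuous_within_mulmx d k (D : set R) (G : 'M[R]_(d, k))
    (y : R -> 'cV[R]_k) i :
  (forall j, {within D, continuous (fun t => y t j 0)}) ->
  {within D, continuous (fun t => (G *m y t) i 0)}.
Proof.
move=> cy; rewrite (_ : (fun t => _) = fun t => \sum_j G i j * y t j 0); last first.
  by apply/funext => t; rewrite mxE.
apply: (@continuous_big R^o _ +%R 0) => [|j _]; first exact: add_continuous.
by move=> t; apply: cvgMr; exact: cy.
Qed.

(** Gronwall's argument applied to the energy [g], the sum of the squares of
    the coordinates of [y].  Its derivative is twice the quadratic form of [G]
    at [y], hence at most [c * g] for a constant [c]; then [h], which is
    [exp (- c t) * g t], is nonincreasing, nonnegative and zero at the
    origin. *)
Lemma linear_ode_zero k (G : 'M[R]_k) (y : R -> 'cV[R]_k) (T : R) :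
    0 < T ->
    (forall i, {within `[0, T], continuous (fun t => y t i 0)}) ->
    (forall t, t \in `[0, T] -> forall i,
      y t i 0 = \int[mu]_(s in `[0, t]) ((G *m y s) i 0)) ->
  y T = 0.
Proof.
move=> T0 cy yE.
have cGy i := @continuous_within_mulmx _ _ _ G _ i cy.
have iGy i : mu.-integrable `[0, T] (EFin \o (fun t => (G *m y t) i 0)).
  exact: continuous_compact_integrable (@segment_compact _ _ _) (cGy i).
(* Only the interior points are usable: the integrand may fail to be
   continuous at the endpoints as a function on the whole line. *)
have dy i t : t \in `]0, T[%R ->
    is_derive t 1 (fun s => y s i 0) ((G *m y t) i 0).
  move=> tT; have [t0 tT'] : 0 < t /\ t < T by rewrite !(itvP tT).
  have Gyt : {for t, continuous (fun s => (G *m y s) i 0)}.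
    exact: within_continuous_continuous T0 (cGy i) tT.
  have [dF F'E] := continuous_FTC1_closed tT' (iGy i) t0 Gyt.
  apply: near_eq_is_derive; last first.
    by rewrite -F'E derive1E; exact: derivableP.
  near=> s; apply/esym/yE.
  have : s \in `]0, T[%R by near: s; exact: near_in_itvoo.
  by rewrite inE /=; exact: subset_itv_oo_cc.
pose g t := \sum_i y t i 0 ^+ 2.
pose c := (\sum_i \sum_j `|G i j|) *+ 2.
pose h t := expR (- c * t) * g t.
have gE : g = \sum_i (fun t => y t i 0) ^+ 2.
  by apply/funext => t; rewrite fct_sumE.
have dg t : t \in `]0, T[%R ->
    is_derive t 1 g ((\sum_i y t i 0 * (G *m y t) i 0) *+ 2).
  move=> tT; have dyt i := dy i _ tT.
  rewrite gE; apply: is_derive_eq.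
  rewrite -sumrMnl; apply: eq_bigr => i _.
  transitivity (2 * y t i 0 * (G *m y t) i 0) => //.
  by rewrite -mulrA mulr_natl.
have dh t : t \in `]0, T[%R -> is_derive t 1 h
   (expR (- c * t) * ((\sum_i y t i 0 * (G *m y t) i 0) *+ 2 - c * g t)).
  move=> tT; have dgt := dg t tT.
  have dE : is_derive t 1 (fun s => expR (- c * s)) (expR (- c * t) * - c).
    apply: (@is_derive1_comp _ expR ( *%R (- c))).
    by apply: is_derive_eq; rewrite /GRing.scale /= mulr1.
  apply: is_derive_eq; rewrite /GRing.scale /=.
  rewrite mulrBr; congr (_ + _).
  by rewrite mulrCA mulrN mulrN [g t * _]mulrC.
have ch : {within `[0, T], continuous h}.
  move=> t; apply: cvgM.
    apply: continuous_subspaceT => {}t; apply: continuous_comp.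
      by apply: cvgMr; exact: cvg_id.
    exact: continuous_expR.
  move: t; apply: (@continuous_big R^o _ +%R 0) => [|i _].
    exact: add_continuous.
  by move=> t; apply: cvgM; exact: cy.
have hT : h T <= h 0.
  apply: (@ler0_derive1_le_cc _ h 0 T) => //.
  - by move=> t /dh[].
  - move=> t tT; rewrite derive1E (@derive_val _ _ _ _ _ _ _ (dh _ tT)).
    rewrite pmulr_rle0 ?expR_gt0 // subr_le0 /c mulrnAl lerMn2r /=.
    exact: quadratic_form_le.
  - by rewrite in_itv /= lexx ltW.
  - by rewrite in_itv /= lexx ltW.
  - exact: ltW.
have g0 : g 0 = 0.
  rewrite /g big1 // => i _; rewrite yE; last by rewrite in_itv /= lexx ltW.
  by rewrite set_itv1 Rintegral_set1 expr0n.
have gT : g T = 0.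
  apply/eqP; rewrite eq_le sumr_ge0 ?andbT; last by move=> i _; exact: sqr_ge0.
  by move: hT; rewrite /h g0 mulr0 pmulr_rle0 // expR_gt0.
apply/matrixP => i j; rewrite ord1 [RHS]mxE; apply/eqP.
rewrite -sqrf_eq0; move/eqP: gT; rewrite /g psumr_eq0; last first.
  by move=> l _; exact: sqr_ge0.
by move/allP/(_ i); rewrite mem_index_enum => /(_ isT).
Unshelve. all: by end_near.
Qed.

End LinearOde.

(** * Controllability *)

(** The input is not seen by [K x], since [K B = 0]; applying [K] to the
    integral equation of the trajectory leaves the equation of an autonomous
    linear system started at zero.  Integrability of the input is what allows
    [K] to be moved under the integral. *)
Lemma trajectory_Krylov (R : realType) n m d (A : 'M[R]_n) (B : 'M[R]_(n, m))
    (K : 'M[R]_(d, n)) (G : 'M[R]_d) (T : R) (u : R -> 'cV[R]_m)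
    (x : R -> 'cV[R]_n) :
    0 < T -> K *m A = G *m K -> K *m B = 0 -> trajectory A B T 0 u x ->
  K *m x T = 0.
Proof.
move=> T0 KA KB [iu cx xE].
apply: (@linear_ode_zero _ _ G (fun t => K *m x t)) => // [i|t tT i].
  exact: continuous_within_mulmx.
have tT' : `[0, t] `<=` `[0, T].
  by apply: subset_itvl; rewrite bnd_simp (itvP tT).
have ix j : (@lebesgue_measure R).-integrable `[0, T] (EFin \o (fun s => x s j 0)).
  exact: continuous_compact_integrable (@segment_compact _ _ _) (cx j).
have ib j : (@lebesgue_measure R).-integrable `[0, t]
    (EFin \o (fun s => (A *m x s + B *m u s) j 0)).
  apply: (@integrableS _ _ _ (@lebesgue_measure R) _ _ _
    (measurable_itv `[0, T]) (measurable_itv `[0, t]) tT').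
  rewrite (_ : EFin \o _ = (EFin \o (fun s => \sum_k A j k * x s k 0%R)%R) \+
                           (EFin \o (fun s => \sum_k B j k * u s k 0%R)%R))%E.
    by apply: integrableD => //; apply: integrable_lincomb.
  by apply/funext => s /=; rewrite !mxE EFinD.
transitivity (\sum_j K i j *
    \int[@lebesgue_measure R]_(s in `[0, t]) ((A *m x s + B *m u s) j 0)).
  by rewrite mxE; apply: eq_bigr => j _; rewrite xE // mxE add0r.
rewrite -Rintegral_lincomb //; apply: eq_Rintegral => s _.
transitivity ((K *m (A *m x s + B *m u s)) i 0); first by rewrite mxE.
by rewrite mulmxDr !mulmxA KA KB mul0mx addr0.
Qed.

(** The easy half of the Kalman rank criterion, in its left-kernel form. *)
Lemma controllable_row_eq0 (R : realType) n m (A : 'M[R]_n.+1)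
    (B : 'M[R]_(n.+1, m)) (v : 'rV[R]_n.+1) :
  controllable A B -> (forall j, v *m A ^+ j *m B = 0) -> v = 0.
Proof.
move=> hAB vB; have [d [K [G [/submxP[a vK] KA Krow]]]] := row_Krylov_mx A v.
have KB : K *m B = 0.
  apply/row_matrixP => i; rewrite row_mul row0.
  by have [j ->] := Krow i; rewrite vB.
apply/row_matrixP => i; rewrite row0 ord1 row_id {i}; apply: trmx_inj.
rewrite trmx0; apply/row_matrixP => i; rewrite row0.
(* Steering the origin to a basis vector reads off one coordinate of [v]. *)
have [T [u [x [T0 xtraj xT]]]] := hAB 0 (delta_mx i 0).
have := trajectory_Krylov T0 KA KB xtraj; rewrite xT => Kd.
apply/matrixP => j k; rewrite !ord1 !mxE.
have /matrixP/(_ 0 0) := congr1 (mulmx a) Kd.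
by rewrite mulmxA -vK mulmx0 -colE !mxE.
Qed.

Theorem proposition1 (R : realType) (n m p : nat)
  (A : 'M[R]_n) (B : 'M[R]_(n, m)) (C : 'M[R]_(p, n)) (L : 'M[R]_(n, p))
  (D : 'I_n -> 'M[R]_n) (hD : resolvent_coefs A C L D)
  (hAB : controllable A B) :
  \rank (parameterization_mx B L D) = n.
Proof.
case: n A B C L D hD hAB => [|n] A B C L D hD hAB.
  by apply/eqP; rewrite -leqn0 rank_leq_row.
apply/eqP/inj_row_free => v vM.
set N := A - L *m C; set F := row_mx B L.
have vDF k : v *m D k *m F = 0.
  apply/matrixP => i j; rewrite ord1 [RHS]mxE.
  have := congr1 (fun M => submxrow M j) vM.
  rewrite mul_mxrow mxrowK => /matrixP/(_ 0 k).
  rewrite mxE [RHS]mxE [in RHS]mxE => <-.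
  transitivity ((v *m (D k *m input_col B L j)) 0 0).
    rewrite mulmxA mxE [RHS]mxE; apply: eq_bigr => l _.
    by rewrite [col _ _ _ _]mxE.
  rewrite mxE; apply: eq_bigr => l _.
  by rewrite [parameterization_block _ _ _ _ _ _]mxE.
pose w := map_mx polyC v *m \sum_(k < n.+1) 'X^k *: map_mx polyC (D k).
have wE : w = \sum_(k < n.+1) 'X^k *: map_mx polyC (v *m D k).
  rewrite /w mulmx_sumr; apply: eq_bigr => k _.
  by rewrite -scalemxAr map_mxM.
have sw k : (size (w 0%R k) <= n.+1)%N.
  rewrite wE summxE; apply: (leq_trans (size_sum _ _ _)).
  apply/bigmax_leqP => j _; rewrite !mxE mulrC mul_polyC.
  by apply: (leq_trans (size_scale_leq _ _)); rewrite size_polyXn.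
have wP : w *m char_poly_mx N = char_poly N *: map_mx polyC v.
  by rewrite -mulmxA (resolvent_coefs_mul hD) mul_mx_scalar.
have wNF j : w *m map_mx polyC (N ^+ j *m F) = 0.
  elim: j => [|j IHj].
    rewrite expr0 mul1mx wE mulmx_suml big1 // => k _.
    by rewrite -scalemxAl -map_mxM vDF map_mx0 scaler0.
  rewrite exprS -[N * _]/(N *m _) -mulmxA.
  by have [_] := char_poly_row_step sw wP IHj.
have vNF j : v *m N ^+ j *m F = 0.
  by rewrite -mulmxA; have [] := char_poly_row_step sw wP (wNF j).
have [vNB vNL] : (forall j, v *m N ^+ j *m B = 0) /\
                 (forall j, v *m N ^+ j *m L = 0).
  by split=> j; have := vNF j; rewrite /F mul_mx_row -row_mx0 => /eq_row_mx[].
apply: (controllable_row_eq0 hAB) => j.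
by rewrite (row_output_injection _ vNL).
Qed.
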